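(* Let $X_1,X_2,\ldots$ be independent random variables with distributions $F_1,F_2,\ldots$ respectively. Assume that $F_1\in\mathcal{P_D}$ and that, for every integer $i>1$, $\overline F_i(x)=o[\overline F_1(x)]$ as $x\to\infty$ and $F_i\in\mathcal{OL}$. Let $N$ be a discrete random variable with values in $\{0,1,\ldots,k\}$ for some $k\in\mathbb{N}$, with $\mathbf{P}[N=0]<1$, independent of $X_1,X_2,\ldots$. Then the distribution $F_{S_N}$ of the randomly stopped sum $S_N:=\sum_{i=1}^NX_i$ (with $S_0:=0$) satisfies $F_{S_N}\in\mathcal{P_D}$.
   Context: For a distribution $F$, $\overline F(x)=1-F(x)$ denotes its tail; all the distributions $F_i$ satisfy $\overline F_i(x)>0$ for every $x\ge0$. Classes of distributions: - $F\in\mathcal{P_D}$ (positively decreasing) if $\limsup_{x\to\infty}\overline F(vx)/\overline F(x)<1$ for some $v>1$. - $F\in\mathcal{OL}$ (generalized long-tailed) if $\limsup_{x\to\infty}\overline F(x-t)/\overline F(x)<\infty$ for every $t\neq 0$. *)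

(* Defs.v *)
From HB Require Import structures.
From mathcomp Require Import all_boot all_order all_algebra.
From mathcomp Require Import finmap.
From mathcomp Require Import all_classical all_reals all_analysis.

Set Implicit Arguments.
Unset Strict Implicit.
Unset Printing Implicit Defensive.

Import Order.TTheory GRing.Theory Num.Theory.
Import numFieldNormedType.Exports.

Local Open Scope classical_set_scope.
Local Open Scope ring_scope.

(* The relation f =o_F g requires F bundled as a filter_on. *)
Canonical pinfty_filter_on (R : realType) :=
  FilterType (pinfty_nbhs R) (@proper_pinfty_nbhs R).

Definition tail (R : realType) (F : probability R R) (x : R) : R :=
  1 - fine (F `]-oo, x]%classic).

(* Both classes are used for distributions whose tail is eventually positive,
   so that the quotients below are genuine (not divisions by 0). *)
Definition positively_decreasing (R : realType) (F : probability R R) : Prop :=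
  exists2 v : R, 1 < v &
    (limf_esup (fun x => (tail F (v * x) / tail F x)%:E) (pinfty_nbhs R)
      < 1)%E.

Definition generalized_long_tailed (R : realType) (F : probability R R) :
    Prop :=
  forall t : R, t != 0 ->
    (limf_esup (fun x => (tail F (x - t) / tail F x)%:E) (pinfty_nbhs R)
      < +oo)%E.

Definition mutually_independent d (T : measurableType d) (R : realType)
    (P : probability T R) (X : nat -> {RV P >-> R}) : Prop :=
  forall (J : {fset nat}) (A : nat -> set R), (forall i, measurable (A i)) ->
    P (\bigcap_(i in [set` J]) (X i @^-1` A i)) =
    (\prod_(i <- J) P (X i @^-1` A i))%E.

Definition generated_events d (T : measurableType d) (R : realType)
    (P : probability T R) (X : nat -> {RV P >-> R}) : set (set T) :=
  <<s [set E | exists i (A : set R), measurable A /\ E = X i @^-1` A] >>.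

Definition independent_of_sequence d (T : measurableType d) (R : realType)
    (P : probability T R) (N : {RV P >-> nat}) (X : nat -> {RV P >-> R}) :
    Prop :=
  forall (B : set nat) (E : set T), generated_events X E ->
    P ((N @^-1` B) `&` E) = (P (N @^-1` B) * P E)%E.

(* Sequences are indexed from 0: the term X i stands for $X_{i+1}$, so that
   the sum over i < n is $X_1 + \dots + X_n$. *)
Definition stopped_sum d (T : measurableType d) (R : realType)
    (P : probability T R) (N : {RV P >-> nat}) (X : nat -> {RV P >-> R})
    (w : T) : R :=
  \sum_(i < N w) X i w.

Section stopped_sum_measurable.
Context d (T : measurableType d) (R : realType) (P : probability T R).
Variables (N : {RV P >-> nat}) (X : nat -> {RV P >-> R}).

Lemma measurable_stopped_sum : measurable_fun setT (stopped_sum N X).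
Proof.
move=> _ B mB; rewrite setTI.
have -> : stopped_sum N X @^-1` B = \bigcup_n
    ((N @^-1` [set n]) `&` ((fun w => \sum_(i < n) X i w) @^-1` B)).
  apply/seteqP; split=> [w Bw|w [n _ [/= <-]]//].
  by exists (N w).
apply: bigcup_measurable => n _; apply: measurableI.
  exact: measurable_funPTI.
rewrite -[X in measurable X]setTI.
have mX : measurable_fun setT (fun w => \sum_(i < n) X i w).
  by apply: measurable_sum => i; exact: measurable_funPT.
exact: mX.
Qed.

HB.instance Definition _ :=
  isMeasurableFun.Build _ _ _ _ (stopped_sum N X) measurable_stopped_sum.

End stopped_sum_measurable.

(* Main.v *)
(* The tail G of S_N is compared with the tail F of X_1 only up to constants and
   dilations. From below, on {N = n, X_1 > x, X_2 > 0, ..., X_n > 0} one has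
   S_N > x, so G(x) >= b F(x) with b = P(N = n) P(X_2 > 0) ... P(X_n > 0).
   From above, S_N > k y forces X_i > y for some i <= k, so G(k y) <= k F(y) for
   large y. Iterating the P_D bound F(v x) <= c F(x) replaces v by v^m and c by
   c^m, and for c^m small enough it absorbs both constants. *)
Require Import Defs.
From mathcomp Require Import all_boot all_order all_algebra.
From mathcomp Require Import finmap.
From mathcomp Require Import all_classical all_reals all_analysis.
From mathcomp Require Import ring lra.

Import Order.TTheory GRing.Theory Num.Theory.
Import numFieldNormedType.Exports.

Set Implicit Arguments.
Unset Strict Implicit.
Unset Printing Implicit Defensive.

Local Open Scope classical_set_scope.
Local Open Scope ring_scope.

Lemma limf_esup_lt_near (T : choiceType) (X : filteredType T) (R : realType)
    (f : X -> \bar R) (F : set_system X) {FF : Filter F} (a : \bar R) :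
  (limf_esup f F < a)%E -> \forall x \near F, (f x < a)%E.
Proof.
rewrite limf_esupE => /ereal_inf_lt[_ [V FV <-] supVa].
apply: filterS FV => x Vx; apply: le_lt_trans supVa.
by apply: ereal_sup_ubound; exists x.
Qed.

Lemma near_limf_esup_le (T : choiceType) (X : filteredType T) (R : realType)
    (f : X -> \bar R) (F : set_system X) (a : \bar R) :
  (\forall x \near F, (f x <= a)%E) -> (limf_esup f F <= a)%E.
Proof.
move=> fa; rewrite limf_esupE.
apply: (@le_trans _ _ (ereal_sup [set f x | x in [set x | (f x <= a)%E]])).
  by apply: ereal_inf_lbound; exists [set x | (f x <= a)%E].
by apply: ge_ereal_sup => _ [x fxa <-].
Qed.

(** The factor in the [P_D] bound can be made as small as desired by enlarging the dilation, since
    [m] iterations turn [c] into [c ^+ m]. *)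
Lemma positively_decreasing_eps (R : realType) (F : probability R R) (e : R) :
    (forall x, 0 <= x -> 0 < tail F x) -> positively_decreasing F -> 0 < e ->
  exists2 v : R, 1 < v & \forall x \near +oo, tail F (v * x) <= e * tail F x.
Proof.
move=> F_gt0 [v v1 limF] e0.
have [c /andP[c0 c1] [M [_ Mc]]] : exists2 c : R, 0 <= c < 1 &
    \forall x \near +oo, tail F (v * x) <= c * tail F x.
  have [c limFc c1] : exists2 c : R,
      (limf_esup (fun x => (tail F (v * x) / tail F x)%:E)
        (pinfty_nbhs R) < c%:E)%E & c < 1.
    (* The limsup is an extended real: for a finite value [r] take the midpoint of [r] and 1, for
       [-oo] take 0. *)
    case E : (limf_esup _ _) limF => [r||] limF; [|by []|].
    - rewrite lte_fin in limF; exists ((r + 1) / 2); last by lra.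
      by rewrite lte_fin; lra.
    - by exists 0; rewrite ?ltNyr.
  (* The factor is made nonnegative so that inequalities may be multiplied by it in the
     iteration. *)
  exists (Num.max c 0).
    by rewrite le_max lexx orbT /= gt_max c1 ltr01.
  have near_c : \forall x \near +oo, ((tail F (v * x) / tail F x)%:E < c%:E)%E.
    exact: limf_esup_lt_near limFc.
  near=> x.
  have x0 : 0 <= x by near: x; exact: nbhs_pinfty_ge.
  rewrite -ler_pdivrMr ?F_gt0// le_max -lee_fin ltW//.
  by near: x.
have v0 : 0 < v by rewrite (lt_trans ltr01).
(* One threshold serves every [m]: for [x > 0] and [v > 1], the point [v ^+ m * x] is at least [x],
   hence still beyond [M]. *)
have iter_c m x : Num.max M 0 < x -> tail F (v ^+ m * x) <= c ^+ m * tail F x.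
  rewrite gt_max => /andP[Mx x0]; elim: m => [|m IHm]; first by rewrite !mul1r.
  rewrite !exprS -!mulrA; apply: (@le_trans _ _ (c * tail F (v ^+ m * x))).
    apply: Mc; apply: lt_le_trans Mx _.
    by rewrite ler_peMl ?(ltW x0)// exprn_ege1// ltW.
  exact: ler_wpM2l.
(* The exponent is a successor because the new dilation [v ^+ m.+1] has to exceed 1 strictly. *)
have [m cm] : exists m, c ^+ m.+1 <= e.
  have : (fun n => c ^+ n) @ \oo --> (0 : R).
    by apply: cvg_expr; rewrite ger0_norm.
  move=> /cvgrPdist_le/(_ e e0)[m _ mP]; exists m.
  have := mP m.+1 (leqnSn m).
  by rewrite sub0r normrN ger0_norm ?exprn_ge0.
exists (v ^+ m.+1); first by rewrite exprn_egt1.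
near=> x.
apply: (@le_trans _ _ (c ^+ m.+1 * tail F x)).
  by apply: iter_c; near: x; apply: nbhs_pinfty_gt; exact: num_real.
by rewrite ler_wpM2r// ltW// F_gt0.
Unshelve. all: by end_near.
Qed.

(** Writing F and G for the tails, G(a v x) <= C F(v x) <= C e F(x) <= (C e / b) G(x) for large x.
    The choice e = b / (2 C) makes the last factor 1/2, and a v is the dilation for [G]. *)
Lemma positively_decreasing_sandwich (R : realType) (F G : probability R R)
    (a b C : R) :
    (forall x, 0 <= x -> 0 < tail F x) -> positively_decreasing F ->
    1 <= a -> 0 < b -> 0 < C ->
    (\forall x \near +oo, b * tail F x <= tail G x) ->
    (\forall x \near +oo, tail G (a * x) <= C * tail F x) ->
  positively_decreasing G.
Proof.
move=> F_gt0 FPD a1 b0 C0 lowG [M [_ upG]].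
have e0 : 0 < b / (2 * C) by rewrite divr_gt0// mulr_gt0.
have [v v1 vF] := @positively_decreasing_eps _ _ _ F_gt0 FPD e0.
have v0 : 0 < v by rewrite (lt_trans ltr01).
exists (a * v); first by rewrite (lt_le_trans v1)// ler_peMl// ltW.
apply: (@le_lt_trans _ _ (2^-1)%:E); last by rewrite lte_fin invf_lt1 ?ltr1n.
apply: near_limf_esup_le; near=> x.
have x0 : 0 <= x by near: x; exact: nbhs_pinfty_ge.
have lowx : b * tail F x <= tail G x by near: x.
have vFx : tail F (v * x) <= b / (2 * C) * tail F x by near: x.
have Mx : M < x by near: x; apply: nbhs_pinfty_gt; exact: num_real.
have upx : tail G (a * (v * x)) <= C * tail F (v * x).
  by apply: upG; rewrite (lt_le_trans Mx)// ler_peMl// ltW.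
(* The lower bound makes the denominator of the quotient for [G] positive. *)
have G0 : 0 < tail G x by rewrite (lt_le_trans _ lowx)// mulr_gt0// F_gt0.
rewrite lee_fin ler_pdivrMr// -mulrA (le_trans upx)//.
rewrite (@le_trans _ _ (C * (b / (2 * C) * tail F x)))//.
  by rewrite ler_wpM2l// ltW.
rewrite (_ : C * _ = 2^-1 * (b * tail F x)); last by field; rewrite gt_eqF.
by rewrite ler_wpM2l.
Unshelve. all: by end_near.
Qed.

Section tails.
Context (R : realType) d (T : measurableType d) (P : probability T R).

Lemma tail_distribution (Y : {RV P >-> R}) (x : R) :
  (tail (distribution P Y) x)%:E = P (Y @^-1` `]x, +oo[%classic).
Proof.
have mI : measurable (Y @^-1` `]-oo, x]%classic) by exact: measurable_funPTI.
rewrite /tail EFinB fineK; last exact: fin_num_measure.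
rewrite /distribution /pushforward -probability_setC//; congr (P _).
by rewrite preimage_setC; congr (_ @^-1` _); exact: setCitvl.
Qed.

Lemma tail_le_sum (X : nat -> {RV P >-> R}) (Y : {RV P >-> R}) (k : nat)
    (a b : R) :
    (forall w, a < Y w -> exists i : 'I_k, b < X i w) ->
  tail (distribution P Y) a <= \sum_(i < k) tail (distribution P (X i)) b.
Proof.
move=> YX; rewrite -lee_fin tail_distribution -sumEFin.
under eq_bigr do rewrite tail_distribution.
have mX i : measurable (X i @^-1` `]b, +oo[%classic).
  exact: measurable_funPTI.
apply: le_trans (@Boole_inequality _ _ _ P
  (fun i => X i @^-1` `]b, +oo[%classic) k _) => //.
apply: le_measure; rewrite ?inE.
- exact: measurable_funPTI.
- exact: bigsetU_measurable.
- move=> w; rewrite -(bigcup_mkord k (fun i => X i @^-1` `]b, +oo[)) /=.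
  rewrite in_itv/= andbT => /YX[i biX].
  by exists i => //=; rewrite in_itv/= andbT.
Qed.

Variables (X : nat -> {RV P >-> R}) (N : {RV P >-> nat}).

(** If [X i w <= y] for all [i < k], the sum is at most [N w] times [y], hence at most [k] times [y]
    because [y] is nonnegative; the union bound then applies. *)
Lemma tail_stopped_sum_le (k : nat) (y : R) :
    (forall w, (N w <= k)%N) -> 0 <= y ->
  tail (distribution P (stopped_sum N X)) (k%:R * y)
    <= \sum_(i < k) tail (distribution P (X i)) y.
Proof.
move=> Nk y0; apply: tail_le_sum => w; apply: contraPP => noX.
apply/negP; rewrite -leNgt /stopped_sum.
apply: (@le_trans _ _ (\sum_(i < N w) y)).
  apply: ler_sum => i _; rewrite leNgt; apply/negP => yX; apply: noX.
  by exists (widen_ord (Nk w) i).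
by rewrite sumr_const card_ord -[leLHS]mulr_natl ler_wpM2r// ler_nat.
Qed.

(** Brings finite intersections within the scope of [independent_of_sequence]. *)
Lemma generated_events_fin_bigcap (J : {fset nat}) (A : nat -> set R) :
    (forall i, measurable (A i)) ->
  generated_events X (\bigcap_(i in [set` J]) (X i @^-1` A i)).
Proof.
move=> mA.
set G := [set E | exists i (A : set R), measurable A /\ E = X i @^-1` A].
apply: (@fin_bigcap_measurable _ (g_sigma_algebraType G)) => // i _.
by apply: sub_sigma_algebra; exists i, (A i).
Qed.

Hypothesis X_indep : mutually_independent X.
Hypothesis N_indep : independent_of_sequence N X.

(** The left side is the exact probability of an event forcing the sum above [x]: independence of
    [N] splits off the first factor, mutual independence the others. No restriction on [x] is
    needed. *)
Lemma tail_stopped_sum_ge (n : nat) (x : R) :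
  fine (P (N @^-1` [set n.+1]))
    * \prod_(i <- iota 1 n) tail (distribution P (X i)) 0
    * tail (distribution P (X 0%N)) x
  <= tail (distribution P (stopped_sum N X)) x.
Proof.
pose J : {fset nat} := [fset i | i in iota 0 n.+1]%fset.
pose A i : set R := if i == 0%N then `]x, +oo[%classic else `]0, +oo[%classic.
have mA i : measurable (A i) by rewrite /A; case: ifP.
pose E := \bigcap_(i in [set` J]) (X i @^-1` A i).
have genE : generated_events X E by exact: generated_events_fin_bigcap.
have mE : measurable E.
  by apply: fin_bigcap_measurable => // i _; exact: measurable_funPTI.
have mN : measurable (N @^-1` [set n.+1]) by exact: measurable_funPTI.
(* The enumeration order of a finite set is not explicit; passing to [iota] lets the factor of index
   0 be taken out of the product. *)
have JE : perm_eq J (iota 0 n.+1).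
  apply: uniq_perm => [||i]; rewrite ?iota_uniq ?fset_uniq//.
  by apply/imfsetP/idP => [[j /= ij ->]|ii] //; exists i.
have PE : P (N @^-1` [set n.+1] `&` E) =
    (fine (P (N @^-1` [set n.+1]))
      * \prod_(i <- iota 1 n) tail (distribution P (X i)) 0
      * tail (distribution P (X 0%N)) x)%:E.
  rewrite N_indep// X_indep// (perm_big _ JE) /= big_cons /= -tail_distribution.
  rewrite (@eq_big_seq _ _ _ _ (iota 1 n) _
    (fun i => (tail (distribution P (X i)) 0)%:E)).
    rewrite prodEFin !EFinM fineK ?fin_num_measure//.
    by rewrite -!muleA; congr (_ * _)%E; rewrite muleC.
  move=> i; rewrite mem_iota => /andP[i0 _].
  by rewrite tail_distribution /A gtn_eqF.
rewrite -lee_fin tail_distribution -PE; apply: le_measure; rewrite ?inE.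
- exact: measurableI.
- exact: measurable_funPTI.
move=> w [/= Nw Ew]; rewrite in_itv/= andbT /stopped_sum Nw.
have XA i : (i < n.+1)%N -> A i (X i w).
  by move=> ni; apply: Ew; rewrite /= (perm_mem JE) mem_iota.
rewrite big_ord_recl ltr_wpDr//.
  apply: sumr_ge0 => i _; have := XA (lift ord0 i) (ltn_ord _).
  by rewrite /A /= in_itv/= andbT => /ltW.
by have := XA 0%N isT; rewrite /A /= in_itv/= andbT.
Qed.

(** Otherwise the event that [N] is nonzero, a countable union of null events, would be null, and
    [N] would vanish almost surely. *)
Lemma exists_pos_probability_succ :
  (P (N @^-1` [set 0%N]) < 1)%E ->
  exists n, (0 < P (N @^-1` [set n.+1]))%E.
Proof.
move=> PN0; apply: contrapT => noN.
have mN n : measurable (N @^-1` [set n]) by exact: measurable_funPTI.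
have PNS n : P (N @^-1` [set n.+1]) = 0%E.
  apply/eqP; rewrite eq_le measure_ge0 andbT leNgt.
  by apply/negP => Nn; apply: noN; exists n.
have : P (~` (N @^-1` [set 0%N])) = 0%E.
  apply/negligibleP; first exact: measurableC.
  have -> : ~` (N @^-1` [set 0%N]) = \bigcup_n (N @^-1` [set n.+1]).
    apply/seteqP; split=> [w /=|w [n _ /= ->]//].
    by case E : (N w) => [//|n] _; exists n.
  by apply: negligible_bigcup => n; apply/negligibleP; [exact: mN|exact: PNS].
rewrite probability_setC// => /eqP.
by rewrite sube_eq ?fin_num_measure// add0e => /eqP P1; rewrite -P1 ltxx in PN0.
Qed.

End tails.

Theorem corollary2p1 (R : realType) (d : measure_display)
    (T : measurableType d) (P : probability T R)
    (X : nat -> {RV P >-> R}) (N : {RV P >-> nat}) (k : nat)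
    (tail_pos : forall (i : nat) (x : R), 0 <= x ->
      0 < tail (distribution P (X i)) x)
    (X_indep : mutually_independent X)
    (F1_PD : positively_decreasing (distribution P (X 0%N)))
    (Fi_o : forall i : nat, (0 < i)%N ->
      tail (distribution P (X i)) =o_ (pinfty_filter_on R)
        tail (distribution P (X 0%N)))
    (Fi_OL : forall i : nat, (0 < i)%N ->
      generalized_long_tailed (distribution P (X i)))
    (N_le : forall w : T, (N w <= k)%N)
    (N_neq0 : (P (N @^-1` [set 0%N]) < 1)%E)
    (N_indep : independent_of_sequence N X) :
  positively_decreasing (distribution P (stopped_sum N X)).
Proof.
have X0_gt0 := tail_pos 0%N.
have [n PNn] := exists_pos_probability_succ N_neq0.
(* An event of positive probability is nonempty, so [N] takes the value [n.+1], which is at most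
   [k]. *)
have k0 : (0 < k)%N.
  rewrite lt0n; apply/negP => /eqP k0; move: PNn.
  suff -> : N @^-1` [set n.+1] = set0 by rewrite measure0 ltxx.
  apply/seteqP; split=> // w /= Nw.
  by have := N_le w; rewrite Nw k0.
apply: (@positively_decreasing_sandwich _ _ _ k%:R
  (fine (P (N @^-1` [set n.+1]))
    * \prod_(i <- iota 1 n) tail (distribution P (X i)) 0) k%:R X0_gt0) => //.
- by rewrite ler1n.
- apply: mulr_gt0; last by apply: prodr_gt0 => i _; exact: tail_pos.
  rewrite fine_gt0// PNn/= ltey_eq fin_num_measure//.
  exact: measurable_funPTI.
- by rewrite ltr0n.
- by near=> x; exact: tail_stopped_sum_ge.
have near_le : \forall x \near +oo, forall i : 'I_k,
    tail (distribution P (X i)) x <= tail (distribution P (X 0%N)) x.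
  (* Finitely many eventual inequalities hold together eventually. Index 0 is trivial; the others
     are the little-o bound with constant 1, where positive tails remove the norms. *)
  apply: filter_forall => -[[|i] ik] /=; first by near=> x.
  have /eqoP/(_ 1 ltr01) := Fi_o i.+1 isT.
  move=> near_o; near=> x.
  have x0 : 0 <= x by near: x; exact: nbhs_pinfty_ge.
  rewrite -[leLHS]ger0_norm ?(ltW (tail_pos _ _ x0))//.
  rewrite -[leRHS]ger0_norm ?(ltW (tail_pos _ _ x0))//.
  by rewrite -[leRHS]mul1r; near: x; exact: near_o.
near=> x.
have x0 : 0 <= x by near: x; exact: nbhs_pinfty_ge.
rewrite (le_trans (tail_stopped_sum_le X N_le x0))//.
apply: (@le_trans _ _ (\sum_(i < k) tail (distribution P (X 0%N)) x)).
  by apply: ler_sum => i _; move: i; near: x.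
by rewrite sumr_const card_ord mulr_natl.
Unshelve. all: by end_near.
Qed.
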